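(* The aggregation methods EwT and EwTC satisfy Proportional Representation (PR), while the aggregation method GSC fails PR. Here an aggregation method $\mathcal{R}$ satisfies PR if for each budgeting scenario $E=(P,V,c,L)$ with $n=|V|$, each $\ell\in\{1,\dots,L\}$, each $V'\subseteq V$ with $|V'|\ge \ell n/L$, and each $P'\subseteq P$ with $c(P')\le \ell$, the following holds: if all voters in $V'$ support all projects in $P'$ and no other projects, then $P'\subseteq\mathcal{R}(E)$.
   Context: Setting. A budgeting scenario is a tuple $E=(P,V,c,L)$: a finite set of projects $P=\{p_1,\dots,p_m\}$; each project $p$ has a cost $c(p)\in\{1,2,\dots\}$; a finite nonempty set of voters $V=\{v_1,\dots,v_n\}$, where voter $v_j$ casts a cumulative ballot, i.e. values $v_j(p)\ge 0$ with $\sum_{p\in P}v_j(p)=1$; and a budget limit $L\in\{1,2,\dots\}$. Voter $v_j$ supports $p$ if $v_j(p)>0$ (in the given ballot). For $B\subseteq P$: $c(B)=\sum_{p\in B}c(p)$, $v_j(B)=\sum_{p\in B}v_j(p)$. An aggregation method $\mathcal{R}$ maps each scenario $E$ to a bundle $\mathcal{R}(E)\subseteq P$ with $c(\mathcal{R}(E))\le L$. Ties are resolved by an arbitrary fixed tie-breaking rule. Rule GSC (Greedy-by-Support-over-Cost). Rank the projects in descending order of $f_{\mathrm{GSC}}(p)=\frac{1}{c(p)}\sum_{j=1}^n v_j(p)\cdot\frac{L}{n}$. Go through the ranking; select the considered project if its cost does not exceed the remaining budget (initially $L$), in which case the remaining budget decreases by its cost; otherwise skip it. Rules EwT and EwTC.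 Each rule keeps a current version of the values $v_j(p)$ (starting from the given ballots, called the initial supports), a set $S$ of selected projects (initially $\emptyset$), and the remaining budget $L-c(S)$. At any time, with the current values and the original $L$, $\mathrm{support}(p)=\frac{L}{n}\sum_{j}v_j(p)$ and $\mathrm{excess}(p)=\mathrm{support}(p)-c(p)$. A remaining (not selected, not eliminated) project $p$ is eligible for funding if $\mathrm{support}(p)\ge c(p)$. The rule loops as follows until every project is selected or eliminated. (A) If some project is eligible for funding, choose the eligible project $p$ with the highest $\mathrm{excess}(p)$ (EwT) or the highest $\mathrm{support}(p)/c(p)$ (EwTC). If $\mathrm{support}(p)>c(p)$, redistribute the excess: let $\mathrm{tran}(p)$ be the set of voters with $v_j(p)>0$ who also have positive current value on some other remaining project; find $\gamma\in[0,1)$ with $\frac{\gamma L}{n}\sum_{v_j\in \mathrm{tran}(p)}v_j(p)+\frac{L}{n}\sum_{v_j\notin \mathrm{tran}(p)}v_j(p)=c(p)$ (if there is no such $\gamma$, bring the support as close to $c(p)$ as possible: use $\gamma=0$; if $\mathrm{tran}(p)=\emptyset$, nothing is transferred). Each $v_j\in\mathrm{tran}(p)$ moves the amount $(1-\gamma)v_j(p)$ from $p$ to the other remaining projects, proportionally to her initial supports for them. Then add $p$ to $S$ and set $v_j(p)=0$ for all $j$ (the voters pay for $p$). (B) If no project is eligible for funding, eliminate the remaining project $p$ with minimal $\mathrm{excess}(p)$ (EwT) or minimal $\mathrm{excess}(p)/c(p)$ (EwTC). Each voter with $v_j(p)>0$ transfers that value to the other remaining projects, proportionally to her initial supports for them;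 if she has support on none of them, no transfer is made. After the loop (reverse eliminations): go through the eliminated projects in the order reverse to that of their elimination, and add each to the bundle if its cost does not exceed the remaining budget. The output is the set of all selected projects. *)

(* Defs.v *)
From HB Require Import structures.
From mathcomp Require Import all_boot all_order all_algebra.
Set Implicit Arguments.
Unset Strict Implicit.
Unset Printing Implicit Defensive.
Import Order.TTheory GRing.Theory Num.Theory.
Local Open Scope ring_scope.

Record scenario (R : realFieldType) := Scenario {
  project : finType;
  voter : finType;
  voter_nonempty : (0 < #|voter|)%N;
  cost : project -> nat;
  cost_gt0 : forall p, (0 < cost p)%N;
  ballot : voter -> project -> R;
  ballot_ge0 : forall v p, 0 <= ballot v p;
  ballot_sum1 : forall v, \sum_p ballot v p = 1;
  limit : nat;
  limit_gt0 : (0 < limit)%N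
}.

Definition bundle_cost (R : realFieldType) (E : scenario R)
    (B : {set project E}) : nat :=
  (\sum_(p in B) cost p)%N.

Record aggregation_method (R : realFieldType) := AggregationMethod {
  outcome :> forall E : scenario R, {set project E};
  outcome_within_limit : forall E, (bundle_cost (outcome E) <= limit E)%N
}.

Definition satisfies_PR (R : realFieldType) (M : aggregation_method R) : Prop :=
  forall (E : scenario R) (l : nat) (V' : {set voter E}) (P' : {set project E}),
    (1 <= l <= limit E)%N ->
    l%:R * #|voter E|%:R / (limit E)%:R <= #|V'|%:R :> R ->
    (bundle_cost P' <= l)%N ->
    (forall v, v \in V' -> forall p, (0 < ballot v p) = (p \in P')) ->
    P' \subset M E.

(* A tie-breaking rule picks one project out of every nonempty set of tied
   projects; it may depend on the scenario. Nothing is required of its value on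
   the empty set, on which the rules below never call it. *)
Record tie_breaking (R : realFieldType) := TieBreaking {
  pick_tied :> forall E : scenario R, {set project E} -> project E;
  pick_tiedP : forall (E : scenario R) (A : {set project E}),
    A != set0 -> pick_tied A \in A
}.

Lemma tie_breaking_exists (R : realFieldType) :
  exists t : tie_breaking R, True.
Proof.
have inh (E : scenario R) : {p : project E | true}.
  case: (pickP (@predT (project E))) => [p _|p0]; first by exists p.
  exfalso; case: (pickP (@predT (voter E))) => [v _|v0].
    have := ballot_sum1 v; rewrite big_pred0 // => /esym/eqP.
    by rewrite oner_eq0.
  by have := voter_nonempty E; rewrite eq_card0.
pose f (E : scenario R) (A : {set project E}) :=
  odflt (sval (inh E)) [pick p in A].
have fP (E : scenario R) (A : {set project E}) : A != set0 -> f E A \in A.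
  case/set0Pn=> p pA; rewrite /f; case: pickP => //= A0.
  by rewrite A0 in pA.
by exists (TieBreaking fP).
Qed.

Definition best (R : realFieldType) (t : tie_breaking R) (E : scenario R)
    (f : project E -> R) (A : {set project E}) : project E :=
  t E [set p in A | [forall q in A, f q <= f p]].

Definition worst (R : realFieldType) (t : tie_breaking R) (E : scenario R)
    (f : project E -> R) (A : {set project E}) : project E :=
  t E [set p in A | [forall q in A, f p <= f q]].

Fixpoint rank_rec (R : realFieldType) (t : tie_breaking R) (E : scenario R)
    (f : project E -> R) (k : nat) (A : {set project E}) : seq (project E) :=
  if k is k'.+1 then
    if A == set0 then [::]
    else best t f A :: rank_rec t f k' (A :\ best t f A)
  else [::].

Definition ranking (R : realFieldType) (t : tie_breaking R) (E : scenario R)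
    (f : project E -> R) : seq (project E) :=
  rank_rec t f #|project E| [set: project E].

Definition greedy (R : realFieldType) (E : scenario R) (B : {set project E})
    (ps : seq (project E)) : {set project E} :=
  foldl (fun S p => if (cost p <= limit E - bundle_cost S)%N then p |: S else S)
    B ps.

Definition f_GSC (R : realFieldType) (E : scenario R) (p : project E) : R :=
  (cost p)%:R^-1 *
  \sum_(v : voter E) ballot v p * ((limit E)%:R / #|voter E|%:R).

Definition GSC_outcome (R : realFieldType) (t : tie_breaking R)
    (E : scenario R) : {set project E} :=
  greedy set0 (ranking t (@f_GSC R E)).

(* [eliminated] lists the most recently eliminated project first. *)
Record state (R : realFieldType) (E : scenario R) := State {
  value : voter E -> project E -> R;
  selected : {set project E};
  eliminated : seq (project E)
}.

Definition init_state (R : realFieldType) (E : scenario R) : state E :=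
  State (@ballot R E) set0 [::].

Definition remaining (R : realFieldType) (E : scenario R) (s : state E)
    : {set project E} :=
  [set p | (p \notin selected s) && (p \notin eliminated s)].

Definition support (R : realFieldType) (E : scenario R) (s : state E)
    (p : project E) : R :=
  (limit E)%:R / #|voter E|%:R * \sum_(v : voter E) value s v p.

Definition excess (R : realFieldType) (E : scenario R) (s : state E)
    (p : project E) : R :=
  support s p - (cost p)%:R.

Definition eligible (R : realFieldType) (E : scenario R) (s : state E)
    : {set project E} :=
  [set p in remaining s | (cost p)%:R <= support s p].

(* Each voter [v] moves [amount v] from [p] to the remaining projects other
   than [p], proportionally to her initial supports. The denominator can vanish
   only for voters whose [amount] is 0 in the rules below. *)
Definition transfer (R : realFieldType) (E : scenario R) (s : state E)
    (p : project E) (amount : voter E -> R) : voter E -> project E -> R :=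
  fun v q =>
    if q == p then value s v p - amount v
    else if q \in remaining s then
      value s v q +
      amount v * (ballot v q / \sum_(r in remaining s :\ p) ballot v r)
    else value s v q.

Definition tran (R : realFieldType) (E : scenario R) (s : state E)
    (p : project E) : {set voter E} :=
  [set v | (0 < value s v p) &&
           [exists q in remaining s :\ p, 0 < value s v q]].

Definition is_gamma (R : realFieldType) (E : scenario R) (s : state E)
    (p : project E) (g : R) : Prop :=
  0 <= g < 1 /\
  g * (limit E)%:R / #|voter E|%:R * (\sum_(v in tran s p) value s v p) +
  (limit E)%:R / #|voter E|%:R * (\sum_(v | v \notin tran s p) value s v p)
  = (cost p)%:R.

(* The only solution of the linear equation in [is_gamma], replaced by 0 when
   it falls outside [0,1); see [gammaP]. *)
Definition gamma (R : realFieldType) (E : scenario R) (s : state E)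
    (p : project E) : R :=
  let u := (limit E)%:R / #|voter E|%:R in
  let g := ((cost p)%:R - u * \sum_(v | v \notin tran s p) value s v p)
           / (u * \sum_(v in tran s p) value s v p) in
  if 0 <= g < 1 then g else 0.

Definition redistributed (R : realFieldType) (E : scenario R) (s : state E)
    (p : project E) : voter E -> R :=
  fun v =>
    if ((cost p)%:R < support s p) && (v \in tran s p)
    then (1 - gamma s p) * value s v p else 0.

Definition fund (R : realFieldType) (E : scenario R) (s : state E)
    (p : project E) : state E :=
  State
    (fun v q => if q == p then 0 else transfer s p (redistributed s p) v q)
    (p |: selected s) (eliminated s).

Definition released (R : realFieldType) (E : scenario R) (s : state E)
    (p : project E) : voter E -> R :=
  fun v =>
    if (0 < value s v p) && [exists q in remaining s :\ p, 0 < ballot v q]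
    then value s v p else 0.

Definition eliminate (R : realFieldType) (E : scenario R) (s : state E)
    (p : project E) : state E :=
  State (transfer s p (released s p)) (selected s) (p :: eliminated s).

Definition criterion (R : realFieldType) : Type :=
  forall E : scenario R, state E -> project E -> R.

(* [sel] is maximized in step (A), [elim] is minimized in step (B). *)
Definition transfer_step (R : realFieldType) (t : tie_breaking R)
    (sel elim : criterion R) (E : scenario R) (s : state E) : state E :=
  if eligible s != set0 then fund s (best t (sel E s) (eligible s))
  else if remaining s != set0 then
    eliminate s (worst t (elim E s) (remaining s))
  else s.

(* Every step removes a remaining project, so [#|project E|] steps exhaust the
   loop; see [transfer_loop_done]. *)
Definition transfer_loop (R : realFieldType) (t : tie_breaking R)
    (sel elim : criterion R) (E : scenario R) : state E :=
  iter #|project E| (@transfer_step R t sel elim E) (init_state E).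

Definition transfer_outcome (R : realFieldType) (t : tie_breaking R)
    (sel elim : criterion R) (E : scenario R) : {set project E} :=
  greedy (selected (transfer_loop t sel elim E))
    (eliminated (transfer_loop t sel elim E)).

Definition support_over_cost (R : realFieldType) : criterion R :=
  fun E s p => support s p / (cost p)%:R.

Definition excess_over_cost (R : realFieldType) : criterion R :=
  fun E s p => excess s p / (cost p)%:R.

Lemma quota_gt0 (R : realFieldType) (E : scenario R) :
  0 < (limit E)%:R / #|voter E|%:R :> R.
Proof. by rewrite divr_gt0 ?ltr0n ?limit_gt0 ?voter_nonempty. Qed.

Lemma gammaP (R : realFieldType) (E : scenario R) (s : state E)
    (p : project E) : tran s p != set0 ->
  is_gamma s p (gamma s p) \/
  gamma s p = 0 /\ forall g, ~ is_gamma s p g.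
Proof.
case/set0Pn=> v0 v0T; have u_gt0 := quota_gt0 E.
have T_gt0 : 0 < \sum_(v in tran s p) value s v p.
  rewrite (bigD1 v0) //= ltr_pwDl //.
    by move: v0T; rewrite inE => /andP[].
  by apply: sumr_ge0 => v /andP[]; rewrite inE => /andP[/ltW].
have uT_neq0 : (limit E)%:R / #|voter E|%:R *
    (\sum_(v in tran s p) value s v p) != 0 by rewrite mulf_neq0 // gt_eqF.
have gA g : g * (limit E)%:R / #|voter E|%:R *
    (\sum_(v in tran s p) value s v p) = g * ((limit E)%:R / #|voter E|%:R *
    (\sum_(v in tran s p) value s v p)) by rewrite !mulrA.
rewrite /gamma; case: ifPn => [g01|ng01]; [left|right].
  by split=> //; rewrite gA divfK ?subrK.
split=> // g [g01]; rewrite gA => gE.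
by move: ng01; rewrite -gE addrK mulfK ?g01.
Qed.

Lemma gamma_bounds (R : realFieldType) (E : scenario R) (s : state E)
    (p : project E) : 0 <= gamma s p < 1.
Proof. by rewrite /gamma; case: ifP => // _; rewrite lexx ltr01. Qed.

Lemma redistributed_ge0 (R : realFieldType) (E : scenario R) (s : state E)
    (p : project E) v : 0 <= redistributed s p v.
Proof.
rewrite /redistributed; case: ifP => // /andP[_]; rewrite inE => /andP[v0 _].
by case/andP: (gamma_bounds s p) => _ g1; rewrite mulr_ge0 ?subr_ge0 ?ltW.
Qed.

Lemma released_ge0 (R : realFieldType) (E : scenario R) (s : state E)
    (p : project E) v : 0 <= released s p v.
Proof. by rewrite /released; case: ifP => // /andP[/ltW]. Qed.

Lemma redistributed_le (R : realFieldType) (E : scenario R) (s : state E)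
    (p : project E) : (cost p)%:R <= support s p ->
  (limit E)%:R / #|voter E|%:R * (\sum_v redistributed s p v) <= excess s p.
Proof.
move=> le_c; rewrite /redistributed /excess.
case: ltP => [lt_c|_] /=; last by rewrite big1 // mulr0 subr_ge0.
rewrite -big_mkcond /= -mulr_sumr.
have [T0|T0] := eqVneq (tran s p) set0.
  by rewrite T0 big_set0 !mulr0 subr_ge0.
set u := _ / _; set T := \sum_(_ in _) _.
have sE : support s p = u * T + u * \sum_(v | v \notin tran s p) value s v p.
  by rewrite -mulrDr /support (bigID (mem (tran s p))).
case: (gammaP T0) => [[_ gE]|[g0 ng]].
  rewrite sE -[(cost p)%:R]gE -/T -[_ * _ / _]mulrA -/u.
  by rewrite opprD addrACA subrr addr0 mulrBl mul1r mulrBr mulrCA mulrA.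
rewrite g0 subr0 mul1r sE -addrA lerDl subr_ge0 leNgt; apply/negP=> lt_c'.
have uT_gt0 : 0 < u * T.
  by move: lt_c; rewrite sE -ltrBlDr; apply: lt_trans; rewrite subr_gt0.
apply: (ng (((cost p)%:R - u * \sum_(v | v \notin tran s p) value s v p)
            / (u * T))); split.
  rewrite divr_ge0 ?subr_ge0 ?ltW //= ltr_pdivrMr // mul1r.
  by rewrite ltrBlDr -sE.
rewrite -/T -/u; set g := (X in X * _ / _ * T).
have -> : g * (limit E)%:R / #|voter E|%:R * T = g * (u * T).
  by rewrite /u !mulrA.
by rewrite divfK ?subrK ?gt_eqF.
Qed.

Lemma remaining_fund (R : realFieldType) (E : scenario R) (s : state E)
    (p : project E) : remaining (fund s p) = remaining s :\ p.
Proof. by apply/setP=> q; rewrite !inE negb_or andbA. Qed.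

Lemma remaining_eliminate (R : realFieldType) (E : scenario R) (s : state E)
    (p : project E) : remaining (eliminate s p) = remaining s :\ p.
Proof. by apply/setP=> q; rewrite !inE negb_or andbCA. Qed.

Lemma best_in (R : realFieldType) (t : tie_breaking R) (E : scenario R)
    (f : project E -> R) (A : {set project E}) : A != set0 -> best t f A \in A.
Proof.
case/set0Pn=> p0 p0A.
suff /(pick_tiedP t) : [set p in A | [forall q in A, f q <= f p]] != set0.
  by rewrite inE => /andP[].
case: (arg_maxP f p0A) => p pA pmax; apply/set0Pn; exists p.
by rewrite inE; apply/andP; split=> //; apply/forall_inP.
Qed.

Lemma worst_in (R : realFieldType) (t : tie_breaking R) (E : scenario R)
    (f : project E -> R) (A : {set project E}) : A != set0 -> worst t f A \in A.
Proof.
case/set0Pn=> p0 p0A.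
suff /(pick_tiedP t) : [set p in A | [forall q in A, f p <= f q]] != set0.
  by rewrite inE => /andP[].
case: (arg_minP f p0A) => p pA pmin; apply/set0Pn; exists p.
by rewrite inE; apply/andP; split=> //; apply/forall_inP.
Qed.

Lemma transfer_loop_done (R : realFieldType) (t : tie_breaking R)
    (sel elim : criterion R) (E : scenario R) :
  remaining (transfer_loop t sel elim E) = set0.
Proof.
suff H k : (#|remaining (iter k (@transfer_step R t sel elim E)
              (init_state E))| <= #|project E| - k)%N.
  by apply/eqP; rewrite -cards_eq0 -leqn0 -(subnn #|project E|) H.
elim: k => [|k IHk]; first by rewrite subn0 max_card.
rewrite iterS; set s := iter _ _ _ in IHk *; rewrite subnS /transfer_step.
case: ifPn => [/(best_in t (sel E s))|_].
  rewrite inE => /andP[pR _]; rewrite remaining_fund.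
  by move: IHk; rewrite (cardsD1 (best t (sel E s) (eligible s))) pR add1n;
    case: (_ - _)%N.
case: ifPn => [/(worst_in t (elim E s)) pR|].
  rewrite remaining_eliminate.
  by move: IHk; rewrite (cardsD1 (worst t (elim E s) (remaining s))) pR add1n;
    case: (_ - _)%N.
by rewrite negbK => /eqP->; rewrite cards0.
Qed.

Lemma transfer_ge0 (R : realFieldType) (E : scenario R) (s : state E)
    (p : project E) (amount : voter E -> R) v q :
  (forall v, 0 <= amount v) ->
  (forall v r, r \in remaining s -> 0 <= value s v r) ->
  q \in remaining s :\ p -> 0 <= transfer s p amount v q.
Proof.
move=> a0 s0; rewrite !inE => /andP[qp]; rewrite /transfer (negPf qp) => qR.
have qRs : q \in remaining s by rewrite inE.
rewrite qRs addr_ge0 ?s0 // mulr_ge0 // divr_ge0 ?ballot_ge0 //.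
by apply: sumr_ge0 => *; apply: ballot_ge0.
Qed.

Lemma transfer_sum_le (R : realFieldType) (E : scenario R) (s : state E)
    (p : project E) (amount : voter E -> R) v : 0 <= amount v ->
  \sum_(q in remaining s :\ p) transfer s p amount v q <=
  \sum_(q in remaining s :\ p) value s v q + amount v.
Proof.
move=> a0; set D := \sum_(r in remaining s :\ p) ballot v r.
have -> : \sum_(q in remaining s :\ p) transfer s p amount v q =
    \sum_(q in remaining s :\ p) (value s v q + amount v * (ballot v q / D)).
  by apply: eq_bigr => q; rewrite in_setD1 /transfer => /andP[/negPf-> ->].
rewrite big_split /= lerD2l -mulr_sumr -mulr_suml -/D ler_piMr //.
by have [->|D0] := eqVneq D 0; rewrite ?mul0r ?ler01 // divff.
Qed.

Definition solvent (R : realFieldType) (E : scenario R) (s : state E) : Prop :=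
  (forall v q, q \in remaining s -> 0 <= value s v q) /\
  (limit E)%:R / #|voter E|%:R * (\sum_v \sum_(q in remaining s) value s v q)
  + (bundle_cost (selected s))%:R <= (limit E)%:R.

Lemma solvent_step (R : realFieldType) (t : tie_breaking R)
    (sel elim : criterion R) (E : scenario R) (s : state E) :
  solvent s -> solvent (transfer_step t sel elim s).
Proof.
move=> solv; have [s0 sL] := solv; have u0 := ltW (quota_gt0 E).
rewrite /transfer_step; case: ifPn => [/(best_in t (sel E s))|_].
  move: (best _ _ _) => p; rewrite inE => /andP[pR le_c].
  have red0 := redistributed_ge0 s p.
  rewrite /solvent remaining_fund /fund /=; split=> [v q qR|].
    have /negPf-> : q != p by move: qR; rewrite in_setD1 => /andP[].
    exact: transfer_ge0.
  apply: le_trans sL.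
  have pS : p \notin selected s by move: pR; rewrite inE => /andP[].
  rewrite /bundle_cost big_setU1 //= natrD addrA lerD2r.
  rewrite [in leRHS](eq_bigr (fun v =>
    value s v p + \sum_(q in remaining s :\ p) value s v q)); last first.
    by move=> v _; rewrite (big_setD1 p).
  rewrite [in leRHS]big_split mulrDr /= -/(support s p) addrC -lerBrDl addrAC.
  rewrite -/(excess s p).
  apply: (le_trans _ (lerD (redistributed_le le_c) (lexx _))).
  rewrite -mulrDr ler_wpM2l // -big_split; apply: ler_sum => v _ /=.
  rewrite addrC; apply: le_trans (transfer_sum_le s p (red0 v)).
  rewrite le_eqVlt; apply/orP; left; apply/eqP/eq_bigr => q.
  by rewrite in_setD1 => /andP[/negPf->].
case: ifPn => [/(worst_in t (elim E s))|//].
move: (worst _ _ _) => p pR; have rel0 := released_ge0 s p.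
rewrite /solvent remaining_eliminate /eliminate /=; split=> [v q qR|].
  exact: transfer_ge0.
apply: le_trans sL; rewrite lerD2r ler_wpM2l //; apply: ler_sum => v _.
rewrite [in leRHS](big_setD1 p) //= addrC.
apply: le_trans (transfer_sum_le s p (rel0 v)) _; rewrite lerD2l /released.
by case: ifP => // _; apply: s0.
Qed.

Lemma solvent_loop (R : realFieldType) (t : tie_breaking R)
    (sel elim : criterion R) (E : scenario R) :
  solvent (transfer_loop t sel elim E).
Proof.
rewrite /transfer_loop; elim: #|project E| => [|k IHk] /=; last first.
  exact: solvent_step.
split=> [v q _|]; first exact: ballot_ge0.
rewrite /bundle_cost big_set0 addr0.
rewrite (eq_bigr (fun=> 1)) => [|v _]; last first.
  rewrite -[RHS](ballot_sum1 v); apply: eq_bigl => q.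
  by rewrite !inE.
by rewrite sumr_const divfK // pnatr_eq0 -lt0n voter_nonempty.
Qed.

Lemma greedy_within_limit (R : realFieldType) (E : scenario R)
    (B : {set project E}) (ps : seq (project E)) :
  (bundle_cost B <= limit E)%N -> (bundle_cost (greedy B ps) <= limit E)%N.
Proof.
elim: ps B => [|p ps IHps] B //= BL; apply: IHps.
case: ifP => // cp; have [pB|pB] := boolP (p \in B).
  by rewrite (setUidPr _) ?sub1set.
by rewrite /bundle_cost big_setU1 //= addnC -leq_subRL.
Qed.

Lemma GSC_within_limit (R : realFieldType) (t : tie_breaking R)
    (E : scenario R) : (bundle_cost (GSC_outcome t E) <= limit E)%N.
Proof. by apply: greedy_within_limit; rewrite /bundle_cost big_set0. Qed.

Lemma transfer_within_limit (R : realFieldType) (t : tie_breaking R)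
    (sel elim : criterion R) (E : scenario R) :
  (bundle_cost (transfer_outcome t sel elim E) <= limit E)%N.
Proof.
apply: greedy_within_limit; rewrite -(ler_nat R).
have [s0 sL] := solvent_loop t sel elim E; apply: le_trans sL.
rewrite lerDr mulr_ge0 //; first exact: ltW (quota_gt0 E).
by apply: sumr_ge0 => v _; apply: sumr_ge0 => q /s0.
Qed.

Definition GSC (R : realFieldType) (t : tie_breaking R)
    : aggregation_method R :=
  AggregationMethod (GSC_within_limit t).

Definition EwT (R : realFieldType) (t : tie_breaking R)
    : aggregation_method R :=
  AggregationMethod (transfer_within_limit t (@excess R) (@excess R)).

Definition EwTC (R : realFieldType) (t : tie_breaking R)
    : aggregation_method R :=
  AggregationMethod
    (transfer_within_limit t (@support_over_cost R) (@excess_over_cost R)).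

(* Main.v *)
(** For any group of voters as in the definition of PR, the transfer rules
    keep the following invariant, whatever quantities [sel] and [elim] they
    optimize. No project of [P'] is eliminated; every voter of [V'] has positive
    value on each remaining project of [P'] and none on the other remaining
    projects; and the money the group holds on the remaining part of [P'] covers
    the cost of that part. Funding [p \in P'] costs the group at most [cost p]:
    if [p] has an excess and is not the last remaining project of [P'], the
    whole group lies in [tran p]. While a part of [P'] remains, one of its
    projects is eligible by averaging, so nothing is eliminated.

    GSC fails because a group that splits its points unevenly can push the
    project it likes least below one of an outsider: with limit 4, two voters
    and ballots (3/4, 1/4, 0) and (0, 0, 1) on projects of costs 1, 1 and 3, the
    outsider's project is funded before the second one. *)
From HB Require Import structures.
From mathcomp Require Import all_boot all_order all_algebra.
From mathcomp Require Import ring lra.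
(* Imported last: MathComp also exports a notation named [support]. *)
Require Import Defs.
Set Implicit Arguments.
Unset Strict Implicit.
Unset Printing Implicit Defensive.
Import Order.TTheory GRing.Theory Num.Theory.
Local Open Scope ring_scope.

(** * Payments and eligibility in one step *)

Lemma sub_greedy (R : realFieldType) (E : scenario R) (B : {set project E})
    (ps : seq (project E)) : B \subset greedy B ps.
Proof.
elim: ps B => [|p ps IHps] B //=; case: ifP => _ //.
by apply: subset_trans (IHps _); apply: subsetUr.
Qed.

Lemma transferE (R : realFieldType) (E : scenario R) (s : state E)
    (p : project E) (amount : voter E -> R) v q : q \in remaining s :\ p ->
  transfer s p amount v q = value s v q +
    amount v * (ballot v q / \sum_(r in remaining s :\ p) ballot v r).
Proof. by rewrite in_setD1 /transfer => /andP[/negPf-> ->]. Qed.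

Lemma sum_value_le_support (R : realFieldType) (E : scenario R) (s : state E)
    (V' : {set voter E}) (p : project E) :
  (forall v, 0 <= value s v p) ->
  (limit E)%:R / #|voter E|%:R * \sum_(v in V') value s v p <= support s p.
Proof.
move=> s0; rewrite ler_wpM2l ?(ltW (quota_gt0 E)) //.
by rewrite [leRHS](bigID (mem V')) /= lerDl sumr_ge0.
Qed.

(** Voters in [tran s p] keep the fraction [gamma s p] of their value on [p], so the equation for
    [gamma] makes the group's payment one nonnegative part of a total of [cost p]. In the fallback
    [gamma s p = 0] the group pays nothing. *)
Lemma paid_le_cost (R : realFieldType) (E : scenario R) (s : state E)
    (V' : {set voter E}) (p : project E) :
  (forall v, 0 <= value s v p) -> (cost p)%:R <= support s p ->
  V' \subset tran s p ->
  (limit E)%:R / #|voter E|%:R *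
    \sum_(v in V') (value s v p - redistributed s p v) <= (cost p)%:R.
Proof.
move=> s0 le_c sVT; have u0 := ltW (quota_gt0 E).
set u := _ / _ in u0 *.
have [lt_c|ge_c] := ltP (cost p)%:R (support s p); last first.
  rewrite (eq_bigr (fun v => value s v p)) => [|v _].
    exact: le_trans (sum_value_le_support V' s0) ge_c.
  by rewrite /redistributed ltNge ge_c subr0.
have [->|T0] := eqVneq V' set0; first by rewrite big_set0 mulr0 ler0n.
rewrite (eq_bigr (fun v => gamma s p * value s v p)) => [|v vV]; last first.
  by rewrite /redistributed lt_c (subsetP sVT) //=; ring.
have /andP[g0 g1] := gamma_bounds s p.
have /gammaP : tran s p != set0.
  by apply: contraNneq T0 => T0; rewrite T0 subset0 in sVT.
case=> [[_ gE]|[-> _]]; last first.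
  by rewrite big1 ?mulr0 ?ler0n // => v _; rewrite mul0r.
rewrite -mulr_sumr -{}gE -/u -[X in X * \sum_(v in tran s p) _]mulrA -/u.
rewrite ler_wpDr //; first by apply: mulr_ge0 => //; apply: sumr_ge0.
rewrite mulrCA mulrA; apply: ler_wpM2l; first exact: mulr_ge0.
by rewrite [leRHS](big_setID V') /= (setIidPr sVT) lerDl sumr_ge0.
Qed.

Lemma eligible_neq0 (R : realFieldType) (E : scenario R) (s : state E)
    (A : {set project E}) : A \subset remaining s -> A != set0 ->
  (bundle_cost A)%:R <= \sum_(q in A) support s q -> eligible s != set0.
Proof.
move=> sA /set0Pn[p pA] le_c; apply: contraTneq le_c => el0.
have lt_c q : q \in A -> support s q < (cost q)%:R.
  move=> qA; rewrite ltNge; apply/negP=> le_c.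
  by move/setP/(_ q): el0; rewrite in_set (subsetP sA) // le_c in_set0.
(* Splitting off one project keeps the summed inequality strict. *)
rewrite -ltNge /bundle_cost natr_sum !(big_setD1 p pA) /=.
rewrite ltr_leD ?lt_c //; apply: ler_sum => q /setD1P[_ qA].
exact/ltW/lt_c.
Qed.

(** * The invariant of a cohesive group *)

Section CohesiveGroup.

Variables (R : realFieldType) (E : scenario R).
Variables (V' : {set voter E}) (P' : {set project E}).
Hypothesis support_group :
  forall v, v \in V' -> forall p, (0 < ballot v p) = (p \in P').

Local Notation u := ((limit E)%:R / #|voter E|%:R : R).

Definition protected (s : state E) : Prop :=
  [/\ forall p, p \in P' -> p \notin eliminated s,
      forall v, v \in V' ->
        forall p, p \in remaining s -> (0 < value s v p) = (p \in P')
    & (bundle_cost (P' :&: remaining s))%:R <=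
        u * \sum_(v in V') \sum_(q in remaining s) value s v q].

Lemma transfer_gt0 (s : state E) p amount v q :
  (forall v r, r \in remaining s -> 0 <= value s v r) ->
  (forall v, 0 <= amount v) -> v \in V' ->
  (0 < value s v q) = (q \in P') -> q \in remaining s :\ p ->
  (0 < transfer s p amount v q) = (q \in P').
Proof.
move=> s0 a0 vV s1 qR; rewrite transferE //; have [qP|qP] := boolP (q \in P').
  rewrite ltr_wpDr ?s1 // mulr_ge0 // divr_ge0 ?ballot_ge0 //.
  by apply: sumr_ge0 => *; apply: ballot_ge0.
have /eqP-> : ballot v q == 0.
  by rewrite eq_le ballot_ge0 leNgt support_group // (negPf qP).
by rewrite mul0r mulr0 addr0 s1 (negPf qP).
Qed.

(** A project of [P'] other than [p] remains, so the normalizing denominator is positive and no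
    money is lost. *)
Lemma sum_transfer (s : state E) p amount v :
  v \in V' -> P' :&: (remaining s :\ p) != set0 ->
  \sum_(q in remaining s :\ p) transfer s p amount v q =
  \sum_(q in remaining s :\ p) value s v q + amount v.
Proof.
move=> vV /set0Pn[p0 /setIP[p0P p0R]].
rewrite (eq_bigr _ (fun q qR => transferE amount v qR)) big_split /=.
rewrite -mulr_sumr -mulr_suml divff ?mulr1 // gt_eqF //.
rewrite (big_setD1 p0) //= ltr_wpDr ?support_group //.
by apply: sumr_ge0 => *; apply: ballot_ge0.
Qed.

Lemma protected_fund (s : state E) p :
  solvent s -> protected s -> p \in eligible s -> protected (fund s p).
Proof.
case=> s0 _ [el sP le_c]; rewrite inE => /andP[pR le_p].
have u0 : 0 <= u := ltW (quota_gt0 E).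
have red0 := redistributed_ge0 s p.
have fundE v q : q \in remaining s :\ p ->
    value (fund s p) v q = transfer s p (redistributed s p) v q.
  by rewrite in_setD1 => /andP[/negPf/= ->].
split=> //.
  move=> v vV q; rewrite remaining_fund => qR.
  rewrite fundE // transfer_gt0 // sP //.
  by move: qR => /setD1P[].
rewrite remaining_fund.
under eq_bigr => v _ do under eq_bigr => q qR do rewrite fundE //.
have [->|PR0] := eqVneq (P' :&: (remaining s :\ p)) set0.
  rewrite /bundle_cost big_set0 mulr_ge0 //.
  by apply: sumr_ge0 => v _; apply: sumr_ge0 => q; apply: transfer_ge0.
under eq_bigr => v vV do rewrite sum_transfer //.
(* The group's money splits into its payment for [p] and what it holds afterwards. *)
have moneyE : u * \sum_(v in V') \sum_(q in remaining s) value s v q =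
    u * \sum_(v in V') (value s v p - redistributed s p v) +
    u * \sum_(v in V')
      (\sum_(q in remaining s :\ p) value s v q + redistributed s p v).
  rewrite -mulrDr -big_split; congr (_ * _); apply: eq_bigr => v _ /=.
  by rewrite (big_setD1 p) //=; ring.
rewrite {}moneyE in le_c; have [pP|pP] := boolP (p \in P').
  have sVT : V' \subset tran s p.
    apply/subsetP=> v vV; rewrite inE sP // pP /=.
    case/set0Pn: PR0 => q /setIP[qP qR].
    apply/existsP; exists q; rewrite qR sP //.
    by move: qR => /setD1P[].
  rewrite -(lerD2l (cost p)%:R).
  apply: le_trans (lerD (paid_le_cost (fun v => s0 v p pR) le_p sVT) (lexx _)).
  apply: le_trans le_c; rewrite -natrD ler_nat /bundle_cost.
  by rewrite [leqRHS](big_setD1 p) /= ?setIDA // in_setI pP.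
(* For [p] outside [P'] the members have value zero on [p] and pay nothing, while the cost still to
   be covered is unchanged. *)
move: le_c; rewrite [X in _ <= u * X + _]big1 ?mulr0 ?add0r => [|v vV].
  have /setDidPl PD : [disjoint P' :&: remaining s & [set p]].
    by rewrite disjoint_sym disjoints1 inE (negPf pP).
  by rewrite setIDA PD.
have sv0 : value s v p = 0.
  by apply/eqP; rewrite eq_le s0 // leNgt sP // (negPf pP).
by rewrite /redistributed sv0 mulr0 if_same subr0.
Qed.

Lemma protected_eligible (s : state E) :
  solvent s -> protected s -> P' :&: remaining s != set0 ->
  eligible s != set0.
Proof.
case=> s0 _ [_ sP le_c] /eligible_neq0; apply; first exact: subsetIr.
(* Counted project by project, the group's money on each [q] is at most [support s q], and it is
   zero outside [P']. *)
apply: le_trans le_c _; rewrite exchange_big mulr_sumr /=.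
rewrite (big_setID P') /= [X in _ + X]big1 ?addr0 => [|q]; last first.
  rewrite inE => /andP[qP qR]; rewrite big1 ?mulr0 // => v vV.
  by apply/eqP; rewrite eq_le s0 // leNgt sP // (negPf qP).
rewrite setIC; apply: ler_sum => q /setIP[_ qR].
exact: sum_value_le_support (fun v => s0 v q qR).
Qed.

(** With nothing eligible, no project of [P'] remains, so [p] lies outside [P'] and there is no cost
    left to cover. *)
Lemma protected_eliminate (s : state E) p :
  solvent s -> protected s -> eligible s = set0 -> p \in remaining s ->
  protected (eliminate s p).
Proof.
move=> solv prot el0 pR; have [s0 _] := solv; have [elP sP _] := prot.
have /eqP PR0 : P' :&: remaining s == set0.
  by apply: contraT => /(protected_eligible solv prot); rewrite el0 eqxx.
have rel0 := released_ge0 s p; split.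
- move=> q qP; rewrite inE negb_or elP // andbT.
  apply: contra_eqT PR0 => /negPn/eqP qp.
  by apply/set0Pn; exists q; rewrite inE qP qp.
- move=> v vV q; rewrite remaining_eliminate => qR.
  by rewrite transfer_gt0 // sP //; move: qR => /setD1P[].
- rewrite remaining_eliminate setIDA PR0 set0D /bundle_cost big_set0.
  apply: mulr_ge0; first exact: ltW (quota_gt0 E).
  by apply: sumr_ge0 => v _; apply: sumr_ge0 => q; apply: transfer_ge0.
Qed.

Lemma protected_step t sel elim (s : state E) :
  solvent s -> protected s -> protected (transfer_step t sel elim s).
Proof.
move=> solv prot; rewrite /transfer_step.
case: ifPn => [/(best_in t (sel E s))|/negPn/eqP el0].
  exact: protected_fund.
by case: ifP => // /(worst_in t (elim E s)); apply: protected_eliminate.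
Qed.

End CohesiveGroup.

(** * Proportional representation for the transfer rules *)

Lemma sum_init_value (R : realFieldType) (E : scenario R) (v : voter E) :
  \sum_(q in remaining (init_state E)) value (init_state E) v q = 1.
Proof. by rewrite -(ballot_sum1 v); apply: eq_bigl => q; rewrite !inE. Qed.

Lemma solvent_init (R : realFieldType) (E : scenario R) :
  solvent (init_state E).
Proof.
split=> [v q _|]; first exact: ballot_ge0.
under eq_bigr => v _ do rewrite sum_init_value.
rewrite /bundle_cost big_set0 addr0 sumr_const divfK //.
by rewrite pnatr_eq0 -lt0n voter_nonempty.
Qed.

Lemma transfer_outcome_PR (R : realFieldType) (t : tie_breaking R)
    (sel elim : criterion R) :
  satisfies_PR (AggregationMethod (transfer_within_limit t sel elim)).
Proof.
move=> E l V' P' _ V'l P'l supp.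
suff [_ [elP _ _]] : solvent (transfer_loop t sel elim E) /\
                     protected V' P' (transfer_loop t sel elim E).
  apply: subset_trans (sub_greedy _ _); apply/subsetP=> p pP.
  (* Nothing remains after the loop, so a project that was not eliminated was selected. *)
  have := in_set0 p; rewrite -(transfer_loop_done t sel elim E) inE elP //.
  by rewrite andbT => /negbFE.
rewrite /transfer_loop; elim: #|project E| => [|k [solv prot]] /=; last first.
  by split; [apply: solvent_step | apply: protected_step].
split; first exact: solvent_init.
split=> // [v vV p _|]; first exact: supp.
under eq_bigr => v _ do rewrite sum_init_value.
(* Each member starts with total value 1; the size of the group makes its money at least [l], which
   bounds the cost of [P']. *)
rewrite sumr_const; apply: (@le_trans _ _ l%:R).
  rewrite ler_nat (leq_trans _ P'l) // /bundle_cost.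
  by rewrite [leqRHS](big_setID (remaining (init_state E))) leq_addr.
have u0 := quota_gt0 E.
by rewrite mulrC -ler_pdivrMr // invf_div mulrA.
Qed.

(** * The counterexample for GSC *)

Lemma best_unique (R : realFieldType) (t : tie_breaking R) (E : scenario R)
    (f : project E -> R) (A : {set project E}) p : p \in A ->
  (forall q, q \in A -> q != p -> f q < f p) -> best t f A = p.
Proof.
move=> pA lt_p; apply/eqP/negPn/negP=> ne_p.
have A0 : A != set0 by apply/set0Pn; exists p.
have := lt_p _ (best_in t f A0) ne_p; apply/negP; rewrite -leNgt.
suff /(pick_tiedP t) : [set p in A | [forall q in A, f q <= f p]] != set0.
  by rewrite inE => /andP[_ /forall_inP]; apply.
apply/set0Pn; exists p; rewrite inE pA; apply/forall_inP=> q qA.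
by have [->//|/(lt_p q qA)/ltW] := eqVneq q p.
Qed.

Section UnevenGroup.

Variable R : realFieldType.

Definition uneven_cost (p : 'I_3) : nat := nth 1%N [:: 1; 1; 3]%N p.

(** Voter [true] forms the group by herself; [false] is the outsider. *)
Definition uneven_ballot (v : bool) (p : 'I_3) : R :=
  nth 0 (if v then [:: 3 / 4; 1 / 4; 0] else [:: 0; 0; 1]) p.

Fact uneven_cost_gt0 p : (0 < uneven_cost p)%N.
Proof. by case: p => -[|[|[|]]]. Qed.

Fact uneven_ballot_ge0 v p : 0 <= uneven_ballot v p.
Proof. by case: v p => -[[|[|[|]]]] //= i; rewrite /uneven_ballot /=; lra. Qed.

Fact uneven_ballot_sum1 v : \sum_p uneven_ballot v p = 1.
Proof.
by rewrite !big_ord_recl big_ord0; case: v; rewrite /uneven_ballot /=; lra.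
Qed.

Fact bool_gt0 : (0 < #|{: bool}|)%N. Proof. by rewrite card_bool. Qed.

Definition uneven : scenario R :=
  Scenario bool_gt0 uneven_cost_gt0 uneven_ballot_ge0 uneven_ballot_sum1
    (isT : (0 < 4)%N).

Lemma f_GSC_uneven (p : 'I_3) :
  @f_GSC R uneven p = nth 0 [:: 3 / 2; 1 / 2; 2 / 3] p.
Proof.
rewrite /f_GSC big_bool /= card_bool /uneven_cost /uneven_ballot.
by case: p => -[|[|[|]]] //= _; lra.
Qed.

Local Notation p0 := (@Ordinal 3 0 isT).
Local Notation p1 := (@Ordinal 3 1 isT).
Local Notation p2 := (@Ordinal 3 2 isT).

(** The three scores are distinct, so the order is the same for every [t]. *)
Lemma ranking_uneven (t : tie_breaking R) :
  ranking t (@f_GSC R uneven) = [:: p0; p2; p1] :> seq 'I_3.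
Proof.
have bestE (A : {set 'I_3}) (p : 'I_3) : p \in A ->
    (forall q : 'I_3, q \in A -> q != p ->
      nth 0 [:: 3 / 2; 1 / 2; 2 / 3] q <
      nth 0 [:: 3 / 2; 1 / 2; 2 / 3] p :> R) ->
    best t (@f_GSC R uneven) A = p.
  move=> pA lt_p; apply: best_unique => // q.
  by rewrite !f_GSC_uneven; apply: lt_p.
have neq0 (A : {set 'I_3}) p : p \in A -> (A == set0) = false.
  by move=> pA; apply/negbTE/set0Pn; exists p.
rewrite /ranking /= card_ord /=.
rewrite (neq0 _ p0) ?inE // (bestE _ p0) ?inE //; last first.
  by case=> -[|[|[|]]] //= i _ _; lra.
rewrite (neq0 _ p2) ?inE // (bestE _ p2) ?inE //; last first.
  by case=> -[|[|[|]]] //= i; rewrite !inE //= => _ _; lra.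
rewrite (neq0 _ p1) ?inE // (bestE _ p1) ?inE //.
by case=> -[|[|[|]]] //= i; rewrite !inE.
Qed.

Lemma GSC_fails_PR (t : tie_breaking R) : ~ satisfies_PR (GSC t).
Proof.
(* The value 2 is tight twice: it is the cost of the two projects, and 2 * 2 / 4 = 1 is the size of
   the group. *)
move=> /(_ uneven 2%N [set true] [set p0; p1]) PR.
have : [set p0; p1] \subset GSC t uneven; first apply: PR.
- by [].
- by rewrite cards1 /= card_bool; lra.
- by rewrite /bundle_cost big_setU1 ?inE //= big_set1.
- move=> v; rewrite inE => /eqP-> p; rewrite !inE /= /uneven_ballot.
  by case: p => -[|[|[|]]] //= i; rewrite ?ltxx ?divr_gt0 ?ltr0n.
move/subsetP/(_ p1); rewrite !inE eqxx orbT => /(_ isT); apply/negP.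
rewrite /= /GSC_outcome ranking_uneven /=.
(* The greedy pass spends 1 on [p0] and 3 on [p2], which exhausts the limit 4 before [p1] is
   considered. *)
have c0 : bundle_cost (set0 : {set project uneven}) = 0%N.
  by rewrite /bundle_cost big_set0.
have c1 : bundle_cost ([set p0] : {set project uneven}) = 1%N.
  by rewrite /bundle_cost big_set1.
have c2 : bundle_cost (p2 |: [set p0] : {set project uneven}) = 4%N.
  by rewrite /bundle_cost big_setU1 ?inE //= big_set1.
by rewrite c0 /= setU0 c1 /= c2 /= !inE.
Qed.

End UnevenGroup.

Theorem theorem5 (R : realFieldType) (t : tie_breaking R) :
  satisfies_PR (EwT t) /\ satisfies_PR (EwTC t) /\ ~ satisfies_PR (GSC t).
Proof.
split; first apply: transfer_outcome_PR.
by split; [apply: transfer_outcome_PR | exact: GSC_fails_PR].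
Qed.
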